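(* Let $\mathbf A=(A_1,\dots,A_n)$ be an $n$-tuple of $n\times n$ hermitian positive semidefinite matrices. Let $\alpha,\alpha^1,\dots,\alpha^m\in L_n$ and suppose $\alpha=\sum_{i=1}^m\gamma_i\alpha^i$ with $\gamma_i\ge0$ and $\sum_{i=1}^m\gamma_i=1$. Then $$\log\big(\mathrm{Cap}^{(\alpha)}\big)\ge\sum_{i=1}^m\gamma_i\log\big(\mathrm{Cap}^{(\alpha^i)}\big),$$ $$\log\big(M^{(\alpha)}\big)\ge\sum_{i=1}^m\gamma_i\log\big(M^{(\alpha^i)}\big)-\log\Big(\frac{n^n}{n!}\Big).$$
   Context: $L_n$ is the set of integer vectors $\alpha=(\alpha_1,\dots,\alpha_n)$ with $\alpha_i\ge0$ and $\sum_i\alpha_i=n$. For $\alpha\in L_n$, $\mathbf A^{(\alpha)}$ is the $n$-tuple $(A_1,\dots,A_1,\dots,A_n,\dots,A_n)$ in which $A_k$ appears $\alpha_k$ times. The mixed discriminant of an $n$-tuple $(B_1,\dots,B_n)$ is $D(B_1,\dots,B_n)=\frac{\partial^n}{\partial t_1\cdots\partial t_n}\det(t_1B_1+\cdots+t_nB_n)$, and its capacity is $\mathrm{Cap}(B_1,\dots,B_n)=\inf\{\det(\sum_i x_iB_i): x_i>0,\ \prod_{i=1}^n x_i=1\}$. $M^{(\alpha)}=D(\mathbf A^{(\alpha)})$ and $\mathrm{Cap}^{(\alpha)}=\mathrm{Cap}(\mathbf A^{(\alpha)})$. The convention $\log 0=-\infty$ is used. *)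

(* Defs.v *)
From HB Require Import structures.
From mathcomp Require Import all_boot all_order all_algebra.
From mathcomp Require Import complex.
(* The notations of mpoly clash with those of MathComp-Analysis. *)
From mathcomp Require mpoly.
Import -(notations) mpoly.
From mathcomp Require Import all_classical all_reals all_analysis.

Set Implicit Arguments.
Unset Strict Implicit.
Unset Printing Implicit Defensive.

Import Order.TTheory GRing.Theory Num.Theory.

Local Open Scope classical_set_scope.
Local Open Scope ring_scope.
Local Open Scope complex_scope.

Definition psdmx (R : realType) (n : nat) (A : 'M[R[i]]_n) : Prop :=
  A \is hermsymmx /\
  forall v : 'rV[R[i]]_n, 0 <= (v *m A *m (map_mx Num.conj v)^T) 0 0.

Definition in_L (n : nat) (alpha : 'I_n -> nat) : Prop :=
  (\sum_(k < n) alpha k)%N = n.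

(* When [in_L alpha] holds the list has length exactly n, so the default
   value 0 of [nth] is never used. *)
Definition repeat_tuple (R : realType) (n : nat) (A : 'I_n -> 'M[R[i]]_n)
    (alpha : 'I_n -> nat) : 'I_n -> 'M[R[i]]_n :=
  fun i => nth 0 (flatten [seq nseq (alpha k) (A k) | k <- enum 'I_n]) i.

(* det (t_1 B_1 + ... + t_n B_n) as a polynomial in t_1, ..., t_n. *)
Definition det_pencil (R : realType) (n : nat) (B : 'I_n -> 'M[R[i]]_n) :
    mpoly n R[i] :=
  \det (\sum_(i < n) mpolyX R[i] (mnm1 i) *:
          map_mx (@mpolyC n R[i]) (B i)).

(* [det_pencil B] is homogeneous of degree n, so its n-th order derivative is a
   constant polynomial and the evaluation point 0 is immaterial. *)
Definition mixed_discriminant (R : realType) (n : nat)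
    (B : 'I_n -> 'M[R[i]]_n) : R[i] :=
  meval (fun=> 0)
    (foldr (@mderiv n R[i]) (det_pencil B) (enum 'I_n)).

(* The determinants below are real for hermitian B_i, hence [complex.Re]. *)
Definition capacity (R : realType) (n : nat) (B : 'I_n -> 'M[R[i]]_n) : R :=
  inf [set complex.Re (\det (\sum_(i < n) (x i)%:C *: B i)) |
       x in [set x : 'I_n -> R |
              (forall i, 0 < x i) /\ \prod_(i < n) x i = 1]].

(* M^(alpha); the mixed discriminant of hermitian matrices is real. *)
Definition M_ (R : realType) (n : nat) (A : 'I_n -> 'M[R[i]]_n)
    (alpha : 'I_n -> nat) : R :=
  complex.Re (mixed_discriminant (repeat_tuple A alpha)).

Definition Cap_ (R : realType) (n : nat) (A : 'I_n -> 'M[R[i]]_n)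
    (alpha : 'I_n -> nat) : R :=
  capacity (repeat_tuple A alpha).

(* Main.v *)
(** Positive semidefinite matrices may be perturbed to positive definite ones,
    since determinants and mixed discriminants are polynomial in the
    perturbation.  For positive definite [B_i] the polynomial
    [p(x) = det(sum_i x_i B_i)] has no zero when all [Re x_i >= 0] and some
    [Re x_i > 0].  By a Gauss-Lucas argument this survives [d/dx_k], and by
    homogeneity [t |-> p(x + t e_k)] has only negative real roots for [x >= 0],
    so it equals [p(x) prod_j (1 + a_j t)] with [a_j > 0].  Differentiating in one
    variable after the other and setting it to 0, the bound
    [prod_j (1 + a_j t) >= t sum_j a_j] gives [D <= Cap], and AM-GM gives
    [D >= (n!/n^n) Cap].  The capacity is log-concave in [alpha]: after AM-GM
    inside each block of equal matrices it is an infimum of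
    [det(sum_k alpha_k w_k A_k)] over [prod_k w_k^alpha_k = 1], and [det] is
    log-concave because [det(Z S^-1) <= exp(tr(Z S^-1) - n)]. *)

Require Import Defs.
From HB Require Import structures.
From mathcomp Require Import all_boot all_order all_algebra.
From mathcomp Require Import complex.
From mathcomp Require mpoly.
Import -(notations) mpoly.
From mathcomp Require Import all_classical all_reals all_analysis.
From mathcomp Require Import ring zify.

Set Implicit Arguments.
Unset Strict Implicit.
Unset Printing Implicit Defensive.

Import Order.TTheory GRing.Theory Num.Theory.
Import numFieldNormedType.Exports.

Local Open Scope classical_set_scope.
Local Open Scope ring_scope.
Local Open Scope complex_scope.

(** * Univariate polynomials as products of factors [1 + a X] *)

Section Univariate.
Variable C : numClosedFieldType.

(** Dividing by [f(0)] rather than by the leading coefficient turns a root [z] into the factor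
    [1 + a X] with [a = - 1 / z]. Each factor is 1 at 0, so [f'(0) / f(0)] is the sum of the [a]. *)
Lemma prod_inverse_roots (f : {poly C}) : f.[0] != 0 ->
  exists s : seq C, [/\ f = f.[0] *: \prod_(a <- s) (1 + a *: 'X),
    size s = (size f).-1 & {in s, forall a, a != 0 /\ f.[- a^-1] = 0}].
Proof.
move=> f0; have [r fE] := closed_field_poly_normal f.
have lcf : lead_coef f != 0.
  by rewrite lead_coef_eq0; apply: contraNneq f0 => ->; rewrite horner0.
have fr z : z \in r -> f.[z] = 0.
  move=> zr; rewrite fE hornerZ; apply/eqP; rewrite mulf_eq0; apply/orP; right.
  by move: (root_prod_XsubC r z); rewrite zr rootE.
have r0 z : z \in r -> z != 0.
  by move=> zr; apply: contraNneq f0 => z0; rewrite -[X in f.[X]]z0 fr.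
pose s := [seq - z^-1 | z <- r].
have fE' : exists c, f = c *: \prod_(a <- s) (1 + a *: 'X).
  exists (lead_coef f * \prod_(z <- r) - z); rewrite [LHS]fE -scalerA.
  congr (_ *: _); rewrite /s big_map; elim: (r) r0 => [|z t IH] tr.
    by rewrite !big_nil scale1r.
  rewrite !big_cons IH => [|y yt]; last by apply: tr; rewrite inE yt orbT.
  have -> : 'X - z%:P = - z *: (1 + - z^-1 *: 'X).
    rewrite scalerDr scalerA mulrN mulNr opprK divff ?tr ?mem_head//.
    by rewrite scale1r scaleNr alg_polyC addrC.
  by rewrite -scalerAl -scalerAr scalerA.
exists s; split.
- case: fE' => c cE; rewrite {1}cE; congr (_ *: _).
  rewrite cE hornerZ horner_prod big1 ?mulr1// => a _.
  by rewrite hornerD hornerZ hornerX mulr0 addr0 hornerC.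
- by rewrite size_map [in RHS]fE size_scale// size_prod_XsubC.
- move=> _ /mapP[z zr ->]; rewrite oppr_eq0 invr_eq0 r0//; split=> //.
  by rewrite invrN opprK invrK fr.
Qed.

Lemma prod_lin_at0 (s : seq C) : (\prod_(a <- s) (1 + a *: 'X)).[0] = 1.
Proof.
rewrite horner_prod big1 // => a _.
by rewrite hornerD hornerZ hornerX mulr0 addr0 hornerC.
Qed.

Lemma deriv_prod_lin_at0 (s : seq C) :
  (\prod_(a <- s) (1 + a *: 'X))^`().[0] = \sum_(a <- s) a.
Proof.
elim: s => [|a s IH]; first by rewrite !big_nil derivC horner0.
rewrite !big_cons derivM hornerD !hornerM IH prod_lin_at0 mulr1.
rewrite derivD derivC add0r derivZ derivX hornerZ hornerC mulr1.
by rewrite hornerD hornerZ hornerX mulr0 addr0 hornerC mul1r.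
Qed.

(* [f'(0) / f(0)] is the sum of the [- 1 / r] over the roots [r], all of which
   lie in the open left half plane. *)
Lemma deriv0_neq0 (f : {poly C}) : (1 < size f)%N ->
  (forall t, 0 <= 'Re t -> f.[t] != 0) -> f^`().[0] != 0.
Proof.
move=> sf fn0; have f0 : f.[0] != 0 by apply: fn0; rewrite raddf0.
have [s [fE ss sr]] := prod_inverse_roots f0.
rewrite fE derivZ hornerZ deriv_prod_lin_at0 mulf_neq0//.
have sa a : a \in s -> 0 < 'Re a.
  move=> /sr[a0 fa]; rewrite real_ltNge ?rpred0 ?Creal_Re//; apply/negP => ra.
  suff /fn0 : 0 <= 'Re (- a^-1) by rewrite fa eqxx.
  have n0 : 0 <= `|a| ^- 2 by rewrite invr_ge0 exprn_ge0.
  rewrite raddfN /= oppr_ge0 invC_norm (ReMl (ger0_real n0)) Re_conj.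
  exact: mulr_ge0_le0.
suff : 0 < 'Re (\sum_(a <- s) a).
  by apply: contraTneq => ->; rewrite raddf0 ltxx.
case: (s) ss sa => [|a t] /= ss sa; first by case: (size f) sf ss => [|[]].
rewrite raddf_sum /= big_cons ltr_pwDl ?sa ?mem_head//.
by rewrite big_seq sumr_ge0// => b bt; rewrite ltW// sa// inE bt orbT.
Qed.

(** All terms of degree at least 2 in [t] are nonnegative and may be dropped. *)
Lemma prod_lin_ge (s : seq C) (t : C) : 0 <= t -> {in s, forall a, 0 < a} ->
  1 + t * \sum_(a <- s) a <= \prod_(a <- s) (1 + t * a).
Proof.
move=> t0; elim: s => [|a s IH] sp; first by rewrite !big_nil mulr0 addr0.
have a0 : 0 < a by apply: sp; rewrite mem_head.
have {}IH : 1 + t * \sum_(a <- s) a <= \prod_(a <- s) (1 + t * a).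
  by apply: IH => b bs; apply: sp; rewrite inE bs orbT.
rewrite !big_cons; apply: (le_trans (y := (1 + t * a) * (1 + t * \sum_(a <- s) a))).
  rewrite mulrDl mul1r (_ : 1 + t * _ = 1 + t * (\sum_(a <- s) a) + t * a).
    rewrite lerD2l mulrDr mulr1 lerDl mulr_ge0 ?mulr_ge0 ?(ltW a0)//.
    by rewrite big_seq sumr_ge0// => b bs; rewrite ltW// sp// inE bs orbT.
  by rewrite mulrDr; ring.
by rewrite ler_wpM2l// addr_ge0// mulr_ge0// ltW.
Qed.

(** AM-GM over exactly [d] factors. The degree along a line is only known to be at most [d], so
    missing factors are filled in by 1. *)
Lemma prod_lin_le (s : seq C) (t : C) d : 0 <= t -> {in s, forall a, 0 < a} ->
  (size s <= d)%N ->
  \prod_(a <- s) (1 + t * a) <= (1 + t * (\sum_(a <- s) a) / d%:R) ^+ d.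
Proof.
move=> t0 sp sd; case: d sd => [|d] sd.
  by case: (s) sd => //; rewrite big_nil expr0.
(* The default 0 of [nth] produces the filling factors [1 + t * 0 = 1]. *)
pose E (i : 'I_d.+1) := 1 + t * nth 0 s i.
have nth0 i : 0 <= nth 0 s i.
  have [si|si] := ltnP i (size s); first by rewrite ltW// sp// mem_nth.
  by rewrite nth_default.
have E0 : {in predT, forall i, 0 <= E i} by move=> i _; rewrite addr_ge0// mulr_ge0.
have [+ _] := leif_AGM E0; rewrite cardT size_enum_ord.
have -> : \prod_(i in predT) E i = \prod_(a <- s) (1 + t * a).
  rewrite (big_nth 0) big_mkord -(subnKC sd) in E nth0 E0 *.
  rewrite (eq_bigl predT)// big_split_ord /= [X in _ * X]big1 ?mulr1//.
  by move=> i _; rewrite /E /= nth_default ?mulr0 ?addr0// leq_addr.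
have -> : \sum_(i in predT) E i = d.+1%:R + t * \sum_(a <- s) a.
  rewrite (eq_bigl predT)// big_split /= sumr_const card_ord -mulr_sumr.
  congr (_ + _ * _); rewrite [RHS](big_nth 0) big_mkord.
  rewrite -(subnKC sd) in E nth0 E0 *.
  rewrite big_split_ord /= [X in _ + X]big1 ?addr0//.
  by move=> i _; rewrite /= nth_default// leq_addr.
by rewrite mulrDl divff ?pnatr_eq0.
Qed.

End Univariate.

(** * Restriction of homogeneous polynomials to lines *)

Section Lines.
Variables (n : nat) (C : numClosedFieldType).
Implicit Types (p : mpoly n C) (z w : 'I_n -> C) (k : 'I_n).

Local Notation homog d p := (p \is ishomog1 d mdeg).

Definition mline p z w : {poly C} :=
  mmap (@polyC C) (fun i => (z i)%:P + w i *: 'X) p.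

Definition unitvec k : 'I_n -> C := fun i => (i == k)%:R.

Lemma horner_mline p z w t :
  (mline p z w).[t] = meval (fun i => z i + t * w i) p.
Proof.
rewrite /mline /mmap mevalE horner_sum; apply: eq_bigr => m _.
rewrite hornerM hornerC /mmap1 horner_prod; congr (_ * _).
apply: eq_bigr => i _.
by rewrite horner_exp hornerD hornerC hornerZ hornerX mulrC.
Qed.

Lemma mlineM z w : {morph (fun p => mline p z w) : p q / p * q}.
Proof. by move=> p q; rewrite /mline rmorphM. Qed.

Lemma mline1 z w : mline 1 z w = 1.
Proof. by rewrite /mline rmorph1. Qed.

(** The product rule carries the identity from 1 and the variables to all monomials, and linearity
    carries it to all polynomials. *)
Lemma deriv_mline p z k :
  (mline p z (unitvec k))^`() = mline (mderiv k p) z (unitvec k).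
Proof.
pose P p := (mline p z (unitvec k))^`() = mline (mderiv k p) z (unitvec k).
have P1 : P 1 by rewrite /P mline1 derivC -mpolyC1 mderivC /mline raddf0.
have PM q r : P q -> P r -> P (q * r).
  rewrite /P => Pq Pr.
  rewrite mlineM derivM Pq Pr mderivM [RHS]raddfD /=.
  by rewrite -!/(mline _ _ _) !mlineM.
have PX i : P (mpolyX C (mnm1 i)).
  rewrite /P mderivX mnm1E /mline mmapX mmap1U derivD derivC add0r.
  rewrite derivZ derivX mmapZ /unitvec.
  case: eqP => [->|_]; last by rewrite mul0r scale0r.
  rewrite mul1r scale1r mmapX /mmap1 big1// => j _.
  by rewrite mnmBE subnn expr0.
elim/mpolyind: p => [|c m p _ _ IH]; first by rewrite mderiv0 /mline raddf0 deriv0.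
have -> : mline (c *: mpolyX C m + p) z (unitvec k) =
    c%:P * mline (mpolyX C m) z (unitvec k) + mline p z (unitvec k).
  by rewrite /mline raddfD /= mmapZ.
rewrite derivD derivM derivC mul0r add0r IH.
rewrite mderivD mderivZ /mline [RHS]raddfD /= mmapZ; congr (_ * _ + _).
have : P (mpolyX C m); last by [].
rewrite mpolyXE_id; apply: big_ind => // i _.
by elim: (m i) => [|e IHe]; rewrite ?expr0 ?exprS //; apply: PM.
Qed.

Lemma size_mline d p z w : homog d p -> (size (mline p z w) <= d.+1)%N.
Proof.
move=> /dhomogP hp; rewrite /mline /mmap big_seq.
apply: (big_ind (fun q : {poly C} => (size q <= d.+1)%N)) => [|q r sq sr|m /hp /= md].
- by rewrite size_poly0.
- by rewrite (leq_trans (size_polyD _ _))// geq_max sq.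
apply: leq_trans (size_polyMleq _ _) _.
have sC : (size (mcoeff m p)%:P <= 1)%N by rewrite size_polyC_leq1.
suff sP : (size (mmap1 (fun i => ((z i)%:P + w i *: 'X)%R) m) <= d.+1)%N.
  by have := leq_add sC sP; move: (_ + _)%N => e; case: e.
rewrite -md mdegE /mmap1.
elim/big_rec2: _ => [|i e q _ sq]; first by rewrite size_poly1.
apply: leq_trans (size_polyMleq _ _) _.
have s2 : (size ((z i)%:P + w i *: 'X)%R <= 2)%N.
  rewrite (leq_trans (size_polyD _ _))// geq_max (leq_trans (size_polyC_leq1 _))//.
  by rewrite (leq_trans (size_scale_leq _ _))// size_polyX.
have s3 : (size (((z i)%:P + w i *: 'X) ^+ m i)%R <= (m i).+1)%N.
  apply: leq_trans (size_poly_exp_leq _ _) _; rewrite ltnS -{2}(mul1n (m i)).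
  by rewrite leq_mul2r; apply/orP; right; case: (size _) s2 => [|[|[]]].
have := leq_add s3 sq; rewrite addSn addnS; move: (_ + size _)%N => v.
by case: v.
Qed.

Lemma meval_homogM d p c z : homog d p ->
  meval (fun i => c * z i) p = c ^+ d * meval z p.
Proof.
move=> /dhomogP hp; rewrite !mevalE mulr_sumr big_seq [RHS]big_seq.
apply: eq_bigr => m /hp /= md.
rewrite mulrCA; congr (_ * _); rewrite -md mdegE -prodrXr -big_split /=.
by apply: eq_bigr => i _; rewrite exprMn.
Qed.

Lemma homog_mderiv d p k : homog d.+1 p -> homog d (mderiv k p).
Proof.
move=> /dhomogP hp; apply/dhomogP => m.
rewrite mcoeff_msupp mcoeff_mderiv => mk.
have /hp /= : mnm_add m (mnm1 k) \in msupp p.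
  by rewrite mcoeff_msupp; apply: contraNneq mk => ->; rewrite mul0rn.
by rewrite mdegD mdeg1 addn1 => -[].
Qed.

End Lines.

(** * Homogeneous polynomials without zeros in a half-space *)

Section Stable.
Variables (n : nat) (C : numClosedFieldType).
Implicit Types (p : mpoly n C) (z w : 'I_n -> C) (k : 'I_n).

Local Notation homog d p := (p \is ishomog1 d mdeg).

(** Zero real parts are allowed as long as one is positive: the points met later have some
    coordinates set to 0. *)
Definition halfspace z : Prop :=
  (forall i, 0 <= 'Re (z i)) /\ exists i, 0 < 'Re (z i).

Definition stable p : Prop := forall z, halfspace z -> meval z p != 0.

Definition nonneg_nonzero z : Prop :=
  (forall i, 0 <= z i) /\ exists i, 0 < z i.

Definition pos_on_orthant p : Prop :=
  forall x, nonneg_nonzero x -> 0 < meval x p.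

Lemma nonneg_halfspace z : nonneg_nonzero z -> halfspace z.
Proof.
move=> [z0 [i zi]]; have zE j : 'Re (z j) = z j by apply/Creal_ReP/ger0_real.
by split=> [j|]; [rewrite zE|exists i; rewrite zE].
Qed.

Lemma halfspace_unitvec k : halfspace (unitvec C k).
Proof.
apply: nonneg_halfspace; split=> [i|]; first by rewrite /unitvec ler0n.
by exists k; rewrite /unitvec eqxx ltr01.
Qed.

Lemma halfspace_line z k t : halfspace z -> 0 <= 'Re t ->
  halfspace (fun i => z i + t * unitvec C k i).
Proof.
move=> [z0 [j zj]] t0.
have E i : 'Re (t * unitvec C k i) = 'Re t * unitvec C k i.
  by rewrite mulrC ReMl 1?mulrC// /unitvec realn.
have P i : 0 <= 'Re (t * unitvec C k i) by rewrite E mulr_ge0// /unitvec ler0n.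
split=> [i|]; first by rewrite raddfD /= addr_ge0.
by exists j; rewrite raddfD /= ltr_wpDr.
Qed.

(** On the line through [z] in direction [e_k] every root has negative real part, so [deriv0_neq0]
    applies once the restriction is known not to be constant. *)
Lemma stable_mderiv d p k : homog d.+1 p -> stable p -> stable (mderiv k p).
Proof.
move=> hp sp z hz.
set f := mline p z (unitvec C k).
have fE t : f.[t] = meval (fun i => z i + t * unitvec C k i) p by rewrite horner_mline.
have -> : meval z (mderiv k p) = f^`().[0].
  rewrite deriv_mline horner_mline; apply: meval_eq => i.
  by rewrite mul0r addr0.
apply: deriv0_neq0; last by move=> t t0; rewrite fE; apply/sp/halfspace_line.
rewrite ltnNge; apply/negP => /size1_polyC fC.
(* If [f] were constant, homogeneity would force [p (e_k) = g (0) = 0]. *)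
pose g := mline p (unitvec C k) z.
have gE s : s != 0 -> g.[s] = s ^+ d.+1 * f`_0.
  move=> s0; rewrite horner_mline.
  have <- : f.[s^-1] = f`_0 by rewrite [in LHS]fC hornerC.
  rewrite fE -meval_homogM//; apply: meval_eq => i.
  by rewrite mulrDr mulVKf// addrC.
(* The formula for [g] is known only away from 0. The factor [X] covers the point 0 and is cancelled
   afterwards. *)
have : (g - f`_0 *: 'X^(d.+1)) * 'X = 0.
  apply/eqP/negPn/negP => /closed_nonrootP[s]; rewrite rootE hornerM hornerX.
  have [->|s0] := eqVneq s 0; first by rewrite mulr0 eqxx.
  by rewrite hornerD hornerN hornerZ hornerXn gE// mulrC mulrBr (mulrC _ f`_0) subrr eqxx.
move=> /eqP; rewrite mulf_eq0 polyX_eq0 orbF subr_eq0 => /eqP gX.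
have /eqP : g.[0] = 0 by rewrite gX hornerZ hornerXn expr0n mulr0.
rewrite horner_mline (meval_eq (v2 := unitvec C k)).
  by apply/negP/sp/halfspace_unitvec.
by move=> i; rewrite mul0r addr0.
Qed.

(** By homogeneity a zero may be multiplied by any complex scalar. If a root [b] of the restriction
    were not a negative real, a suitable scalar would move the zero [x + b e_k] into the
    half-space. *)
Lemma line_pos_roots d p k x : homog d p -> stable p -> pos_on_orthant p ->
  nonneg_nonzero x ->
  exists s : seq C, [/\ (size s <= d)%N, {in s, forall a, 0 < a},
    forall t, meval (fun i => x i + t * unitvec C k i) p =
       meval x p * \prod_(a <- s) (1 + t * a) &
    meval x (mderiv k p) = meval x p * \sum_(a <- s) a].
Proof.
move=> hp sp pp hx.
set f := mline p x (unitvec C k).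
have fE t : f.[t] = meval (fun i => x i + t * unitvec C k i) p by rewrite horner_mline.
have x0E i : x i + 0 * unitvec C k i = x i by rewrite mul0r addr0.
have f0E : f.[0] = meval x p by rewrite fE; apply: meval_eq.
have f0 : f.[0] != 0 by rewrite f0E gt_eqF// pp.
have [s [fs ss sr]] := prod_inverse_roots f0.
exists s; split.
- by rewrite ss -ltnS prednK ?size_mline// lt0n size_poly_eq0; apply: contraNneq f0 => ->; rewrite horner0.
- move=> a /sr[a0 fa].
  have [//|na] := boolP (0 < a); exfalso.
  have b0 : - a^-1 != 0 by rewrite oppr_eq0 invr_eq0.
  set b := - a^-1 in fa b0.
  have nb : 0 < `|b| by rewrite normr_gt0.
  have rb : 0 < `|b| + 'Re b.
    rewrite -[X in _ + X]opprK subr_gt0 -raddfN /= -(normrN b).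
    rewrite (lt_leif (leif_Re_Creal _)) opprK invr_ge0.
    by move: na; rewrite lt_def a0.
  (* Rotating by [c] moves both [c * x] and [c * b] into the open half plane. *)
  pose c := `|b| + b^*.
  have : meval (fun i => c * (x i + b * unitvec C k i)) p = 0.
    by rewrite (meval_homogM _ _ hp) -fE fa mulr0.
  apply/eqP/sp; case: hx => [x0 [j xj]].
  (* Since [c * b = |b| (|b| + b)], both summands acquire the same positive factor [|b| + Re b]. *)
  have E i : 'Re (c * (x i + b * unitvec C k i)) =
      (`|b| + 'Re b) * (x i + `|b| * unitvec C k i).
    have -> : c * (x i + b * unitvec C k i) =
        x i * c + `|b| * unitvec C k i * (`|b| + b).
      by rewrite mulrDr mulrC; congr (_ + _); rewrite /c mulrDl [b^* * _]mulrA -normCKC; ring.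
    have rR u : 'Re (`|b| + u) = `|b| + 'Re u.
      by rewrite raddfD /=; congr (_ + _); apply/Creal_ReP/normr_real.
    rewrite raddfD /= !ReMl ?rR ?Re_conj; first by ring.
      by rewrite rpredM ?normr_real// /unitvec realn.
    exact/ger0_real.
  split=> [i|]; first by rewrite E mulr_ge0 ?(ltW rb)// addr_ge0// mulr_ge0// /unitvec ler0n.
  by exists j; rewrite E mulr_gt0// ltr_wpDr// mulr_ge0// /unitvec ler0n.
- move=> t; rewrite -fE fs hornerZ f0E horner_prod; congr (_ * _).
  by apply: eq_bigr => a _; rewrite hornerD hornerZ hornerX hornerC mulrC.
- transitivity f^`().[0].
    by rewrite deriv_mline horner_mline; apply: meval_eq.
  by rewrite fs derivZ hornerZ deriv_prod_lin_at0 f0E.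
Qed.

(** The root description alone gives a nonnegative value, because [s] might be empty; stability of
    the derivative excludes 0. *)
Lemma pos_mderiv d p k : homog d.+1 p -> stable p -> pos_on_orthant p ->
  pos_on_orthant (mderiv k p).
Proof.
move=> hp sp pp x hx.
have [s [_ s0 _ E]] := line_pos_roots k hp sp pp hx.
rewrite lt_def (stable_mderiv k hp sp (nonneg_halfspace hx)) E mulr_ge0//.
  exact/ltW/pp.
by rewrite big_seq sumr_ge0// => a /s0/ltW.
Qed.

Lemma mderiv_le d p k x t : homog d p -> stable p -> pos_on_orthant p ->
  nonneg_nonzero x -> 0 <= t ->
  t * meval x (mderiv k p) <= meval (fun i => x i + t * unitvec C k i) p.
Proof.
move=> hp sp pp hx t0.
have [s [_ s0 E1 E2]] := line_pos_roots k hp sp pp hx.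
rewrite E1 E2 mulrCA ler_wpM2l ?(ltW (pp _ hx))//.
by rewrite (le_trans _ (prod_lin_ge t0 s0))// lerDr.
Qed.

(* Evaluate AM-GM for the factors [1 + t a] at the critical
   [t = (d+2) / ((d+1) s)] with [s] the sum of the [a]'s. *)
Lemma mderiv_ge d p k x c : homog d.+2 p -> stable p -> pos_on_orthant p ->
  nonneg_nonzero x ->
  (forall t, 0 < t -> c * t <= meval (fun i => x i + t * unitvec C k i) p) ->
  c * (d.+1%:R / d.+2%:R) ^+ d.+1 <= meval x (mderiv k p).
Proof.
move=> hp sp pp hx hc.
have pos := pos_mderiv k hp sp pp hx.
have [s [ss s0 E1 E2]] := line_pos_roots k hp sp pp hx.
have p0 := pp _ hx.
set S := \sum_(a <- s) a in E2.
have S0 : 0 < S by move: pos; rewrite E2 pmulr_rgt0.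
pose t : C := d.+2%:R / (d.+1%:R * S).
have t0 : 0 < t by rewrite divr_gt0// mulr_gt0 ?ltr0n.
have := hc t t0; rewrite E1 => H.
have {H} : c * t <= meval x p * (1 + t * S / d.+2%:R) ^+ d.+2.
  by rewrite (le_trans H)// ler_wpM2l ?(ltW p0)// prod_lin_le// ltW.
have -> : 1 + t * S / d.+2%:R = d.+2%:R / d.+1%:R.
  have gen (u v w : C) : u != 0 -> v != 0 -> w != 0 -> v = u + 1 ->
      1 + v / (u * w) * w / v = v / u.
    by move=> u0 v0 w0 vu; rewrite {3}vu; field; rewrite u0 v0.
  by apply: gen; rewrite ?pnatr_eq0 ?(gt_eqF S0)// natr1.
rewrite E2 -(ler_pM2r (x := t^-1)) ?invr_gt0// mulfK ?gt_eqF// => H.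
rewrite -(ler_pM2r (x := (d.+2%:R / d.+1%:R) ^+ d.+1)) ?exprn_gt0 ?divr_gt0 ?ltr0n//.
rewrite -[d.+1%:R / _]invf_div -mulrA -exprMn mulVf ?expr1n ?mulr1; last first.
  by rewrite mulf_neq0// ?invr_eq0 pnatr_eq0.
have gen (q u v w : C) : u != 0 -> v != 0 -> w != 0 ->
    meval x p * (q * (v / u)) * (v / (u * w))^-1 = meval x p * w * q.
  by move=> u0 v0 w0; field; rewrite ?u0 ?v0 ?w0.
apply: le_trans H _; rewrite exprSr /t gen ?pnatr_eq0 ?(gt_eqF S0)//.
Qed.

(** Serves the last differentiation, whose base point 0 lies outside [halfspace], so that linearity
    has to replace the root description. *)
Lemma homog1_line p k t : homog 1 p ->
  meval (fun i => t * unitvec C k i) p = t * meval (fun=> 0) (mderiv k p).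
Proof.
move=> hp; rewrite (meval_homogM _ _ hp) expr1; congr (_ * _).
set f := mline p (fun=> 0) (unitvec C k).
have sf : (size f <= 2)%N by exact: size_mline.
have -> : meval (unitvec C k) p = f.[1].
  by rewrite horner_mline; apply: meval_eq => i; rewrite add0r mul1r.
have -> : meval (fun=> 0) (mderiv k p) = f^`().[0].
  by rewrite deriv_mline horner_mline; apply: meval_eq => i; rewrite add0r mul0r.
have f0 : f.[0] = 0.
  rewrite horner_mline (meval_eq (v2 := fun i => 0 * 0)) => [|i]; last by rewrite add0r !mul0r.
  by rewrite (meval_homogM _ _ hp) expr1 mul0r.
move: f0; rewrite !horner_coef0 (horner_coef_wide _ sf) coef_deriv.
by rewrite !big_ord_recl big_ord0 /= => ->; rewrite !expr1n mul0r add0r addr0 mulr1.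
Qed.

End Stable.

(** * Definite matrices and their relative eigenvalues *)

Section Definite.
Variables (C : numClosedFieldType).

Definition qform n (A : 'M[C]_n) (v : 'rV[C]_n) : C :=
  (v *m A *m (map_mx Num.conj v)^T) 0 0.

(** In the order of [C] a comparison with 0 includes being real, and a matrix whose form has only
    real values is hermitian. *)
Definition posdef n (A : 'M[C]_n) := forall v, v != 0 -> 0 < qform A v.
Definition possemidef n (A : 'M[C]_n) := forall v, 0 <= qform A v.

Variable n : nat.
Implicit Types (A S Z : 'M[C]_n) (v : 'rV[C]_n).

Lemma qformD A Z v : qform (A + Z) v = qform A v + qform Z v.
Proof. by rewrite /qform mulmxDr mulmxDl mxE. Qed.

Lemma qformZ c A v : qform (c *: A) v = c * qform A v.
Proof. by rewrite /qform -scalemxAr -scalemxAl mxE. Qed.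

Lemma qform_sum I (r : seq I) (P : pred I) (F : I -> 'M[C]_n) v :
  qform (\sum_(i <- r | P i) F i) v = \sum_(i <- r | P i) qform (F i) v.
Proof. by rewrite /qform mulmx_sumr mulmx_suml summxE. Qed.

Lemma posdef_possemidef A : posdef A -> possemidef A.
Proof.
move=> pA v; have [->|v0] := eqVneq v 0; last exact/ltW/pA.
by rewrite /qform !mul0mx mxE.
Qed.

Lemma posdef1 : posdef (1%:M : 'M[C]_n).
Proof.
move=> v v0; rewrite /qform mulmx1 mxE.
rewrite lt_def sumr_ge0 ?andbT => [|i _]; last by rewrite !mxE mul_conjC_ge0.
apply: contraNneq v0 => /eqP; rewrite psumr_eq0 => [/allP v0|i _]; last first.
  by rewrite !mxE mul_conjC_ge0.
apply/eqP/rowP => i; have := v0 i (mem_index_enum _).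
by rewrite !mxE mul_conjC_eq0 => /eqP.
Qed.

Lemma possemidef_sum I (r : seq I) (c : I -> C) (F : I -> 'M[C]_n) :
  (forall i, 0 <= c i) -> (forall i, possemidef (F i)) ->
  possemidef (\sum_(i <- r) c i *: F i).
Proof.
move=> c0 pF v; rewrite qform_sum sumr_ge0// => i _.
by rewrite qformZ mulr_ge0//; apply: pF.
Qed.

Lemma posdefD1 A e : possemidef A -> 0 < e -> posdef (A + e *: 1%:M).
Proof.
move=> pA e0 v v0; rewrite qformD qformZ ltr_wpDl//.
by rewrite mulr_gt0// posdef1.
Qed.

(** The form vanishes at a kernel vector. Working with the real part covers complex combinations of
    definite matrices. *)
Lemma Re_qform_det_neq0 A : (forall v, v != 0 -> 0 < 'Re (qform A v)) ->
  \det A != 0.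
Proof.
move=> pA; apply/det0P => -[v v0 vA]; have := pA v v0.
by rewrite /qform vA mul0mx mxE raddf0 ltxx.
Qed.

Lemma posdef_unitmx S : posdef S -> S \in unitmx.
Proof.
move=> pS; rewrite unitmxE unitfE; apply: Re_qform_det_neq0 => v /pS qv.
by rewrite (Creal_ReP _ _)// gtr0_real.
Qed.

(** The [a] are the roots of the characteristic polynomial of [Z S^-1], whose coefficients give
    determinant and trace. A left eigenvector yields [v Z = a v S], so [a] is a quotient of the two
    forms, and no diagonalization is involved. *)
Lemma relative_eigenvalues S Z : posdef S ->
  exists s : seq C, [/\ size s = n, \det Z = \det S * \prod_(a <- s) a,
    \tr (Z *m invmx S) = \sum_(a <- s) a &
    {in s, forall a, exists2 v, v != 0 & qform Z v = a * qform S v}].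
Proof.
move=> pS; have uS := posdef_unitmx pS; set T := Z *m invmx S.
have [s sE] := closed_field_poly_normal (char_poly T).
rewrite (monicP (char_poly_monic T)) scale1r in sE.
have ss : size s = n.
  by have := size_char_poly T; rewrite sE size_prod_XsubC => -[].
exists s; split=> //.
- have ZE : Z = T *m S by rewrite mulmxKV.
  rewrite ZE det_mulmx mulrC; congr (_ * _).
  have := char_poly_det T; rewrite sE coef0_prod_XsubC ss => /mulfI-> //.
  by rewrite signr_eq0.
(* The trace is read off the coefficient of index [n - 1], which requires [n] to be positive. *)
- have [n0|n0] := posnP n; last first.
    apply: oppr_inj; rewrite -char_poly_trace// sE -ss coefPn_prod_XsubC//.
    by rewrite ss -lt0n.
  rewrite /mxtrace big1 => [|i _]; last first.
    by have := ltn_ord i; rewrite [X in (_ < X)%N]n0.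
  by rewrite (size0nil (etrans ss n0)) big_nil.
- move=> a sa; have : root (char_poly T) a by rewrite sE root_prod_XsubC.
  rewrite -eigenvalue_root_char => /eigenvalueP[v vT v0]; exists v => //.
  have vZ : v *m Z = a *: (v *m S).
    by rewrite -[in LHS](mulmxKV uS Z) mulmxA vT scalemxAl.
  by rewrite /qform vZ -scalemxAl mxE.
Qed.

Lemma det_posdef_gt0 S : posdef S -> 0 < \det S.
Proof.
move=> pS; have [s [_ -> _ sv]] := relative_eigenvalues S posdef1.
rewrite det1 mul1r big_seq prodr_gt0// => a /sv[v v0 E].
by have := pS v v0; rewrite E pmulr_lgt0// posdef1.
Qed.

Lemma relative_eigenvalues_ge0 S Z (s : seq C) : posdef S -> possemidef Z ->
  {in s, forall a, exists2 v, v != 0 & qform Z v = a * qform S v} ->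
  {in s, forall a, 0 <= a}.
Proof.
move=> pS pZ sv a /sv[v v0 E].
by have := pZ v; rewrite E pmulr_lge0// pS.
Qed.

Lemma det_possemidef_ge0 Z : possemidef Z -> 0 <= \det Z.
Proof.
move=> pZ; have [s [_ -> _ sv]] := relative_eigenvalues Z posdef1.
rewrite det1 mul1r big_seq prodr_ge0//.
exact: relative_eigenvalues_ge0 posdef1 pZ sv.
Qed.

Lemma relative_eigenvalues_le1 S Z (s : seq C) : posdef S -> possemidef (S - Z) ->
  {in s, forall a, exists2 v, v != 0 & qform Z v = a * qform S v} ->
  {in s, forall a, a <= 1}.
Proof.
move=> pS pZ sv a /sv[v v0 E].
have := pZ v; rewrite -scaleN1r qformD qformZ E mulN1r -{1}(mul1r (qform S v)).
by rewrite -mulrBl pmulr_lge0 ?pS// subr_ge0.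
Qed.

(** The eigenvalues of [Z S^-1] lie between 0 and 1. *)
Lemma det_le S Z : posdef S -> possemidef Z -> possemidef (S - Z) ->
  \det Z <= \det S.
Proof.
move=> pS pZ pSZ; have [s [_ -> _ sv]] := relative_eigenvalues Z pS.
rewrite -[leRHS]mulr1 ler_wpM2l ?(ltW (det_posdef_gt0 pS))//.
rewrite big_seq prodr_ile1// => a sa.
by rewrite (relative_eigenvalues_ge0 pS pZ sv)// (relative_eigenvalues_le1 pS pSZ sv).
Qed.

End Definite.

(** * The determinantal polynomial of a tuple of matrices *)

Section Pencil.
Variables (n : nat) (C : numClosedFieldType) (B : 'I_n -> 'M[C]_n).

Let pencil : mpoly n C := \det (\sum_(i < n) mpolyX C (mnm1 i) *:
          map_mx (@mpolyC n C) (B i)).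

Lemma meval_det_pencil z : meval z pencil = \det (\sum_i z i *: B i).
Proof.
rewrite /pencil -det_map_mx; congr (\det _); apply/matrixP => i j.
rewrite !(mxE, summxE) raddf_sum /=; apply: eq_bigr => k _.
by rewrite !mxE mevalM mevalXU mevalC.
Qed.

Lemma homog_det_pencil : pencil \is ishomog1 n mdeg.
Proof.
rewrite /pencil /determinant rpred_sum// => s _.
set P := \prod_i _; suff H : P \is ishomog1 n mdeg.
  by case: (perm.odd_perm s); rewrite ?expr0 ?expr1 ?mul1r// mulN1r rpredN.
(* Writing [n] as a sum of ones matches the degree with the product of [n] linear entries. *)
have -> : ishomog1 n mdeg = ishomog1 (\sum_(i < n) 1)%N mdeg :> qualifier 0 (mpoly n C).
  by rewrite sum1_card card_ord.
rewrite /P; elim/big_rec2: _ => [|i q d _ hq]; first exact: dhomog1.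
apply: dhomogM => //; rewrite summxE rpred_sum// => k _.
by rewrite !mxE mulrC mul_mpolyC dhomogZ// dhomogX /= mdeg1.
Qed.

(** The form of each [B i] is real, so the real part of the form of the sum is a combination of
    these forms with weights [Re (z i)]. *)
Lemma stable_det_pencil : (forall i, posdef (B i)) -> stable pencil.
Proof.
move=> pB z [z0 [j zj]]; rewrite meval_det_pencil; apply: Re_qform_det_neq0 => v v0.
rewrite qform_sum raddf_sum /=.
have E i : 'Re (qform (z i *: B i) v) = qform (B i) v * 'Re (z i).
  by rewrite qformZ mulrC ReMl ?gtr0_real ?pB.
rewrite (bigD1 j)//= ltr_pwDl// ?E ?mulr_gt0 ?pB// sumr_ge0// => i _.
by rewrite E mulr_ge0// ltW// pB.
Qed.

Lemma pos_det_pencil : (forall i, posdef (B i)) -> pos_on_orthant pencil.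
Proof.
move=> pB x [x0 [j xj]]; rewrite meval_det_pencil; apply: det_posdef_gt0 => v v0.
rewrite qform_sum (bigD1 j)//= ltr_pwDl// ?qformZ ?mulr_gt0 ?pB//.
by rewrite sumr_ge0// => i _; rewrite qformZ mulr_ge0// ltW// pB.
Qed.

End Pencil.

(** * Bounds on the full mixed derivative, one variable at a time *)

Section CapacityInequalities.
Variables (n : nat) (C : numClosedFieldType) (p : mpoly n C).
Hypotheses (hp : p \is ishomog1 n mdeg) (sp : stable p) (pp : pos_on_orthant p).
Implicit Types (x : 'I_n -> C).

(** The variables of index at least [k] have been differentiated, which leaves degree [k]:
    [pderiv n] is [p] and [pderiv 0] is constant. [trunc x k] sets these same variables to 0. *)
Definition pderiv k := foldr (@mderiv n C) p (drop k (enum 'I_n)).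

Definition trunc x k : 'I_n -> C := fun i => if (i < k)%N then x i else 0.

Lemma pderiv_ord (k : 'I_n) : pderiv k = mderiv k (pderiv k.+1).
Proof. by rewrite /pderiv (drop_nth k) ?size_enum_ord ?nth_ord_enum. Qed.

Lemma pderiv_props k : (k <= n)%N ->
  [/\ pderiv k \is ishomog1 k mdeg, stable (pderiv k) & pos_on_orthant (pderiv k)].
Proof.
move=> kn; rewrite -(subKn kn); move: (n - k)%N (leq_subr k n) => j.
elim: j => [_|j IH jn].
  by rewrite subn0 /pderiv drop_oversize ?size_enum_ord.
have jn' : (n - j.+1 < n)%N by lia.
have E : (n - j = (n - j.+1).+1)%N by lia.
have [] := IH (ltnW jn); rewrite E => h s q.
have := pderiv_ord (Ordinal jn') => /= ->.
by split; [exact: homog_mderiv|exact: stable_mderiv h s|exact: pos_mderiv h s q].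
Qed.

Lemma truncS x (k : 'I_n) i : trunc x k.+1 i = trunc x k i + x k * unitvec C k i.
Proof.
rewrite /trunc /unitvec ltnS leq_eqVlt.
have [->|ik] := eqVneq i k; first by rewrite eqxx ltnn /= add0r mulr1.
by rewrite val_eqE (negbTE ik) /= mulr0 addr0.
Qed.

Lemma trunc_nonneg x k : (0 < n)%N -> (0 < k)%N -> (forall i, 0 < x i) ->
  nonneg_nonzero (trunc x k).
Proof.
move=> n0 k0 x0; split=> [i|]; first by rewrite /trunc; case: ifP => // _; apply: ltW.
by exists (Ordinal n0); rewrite /trunc k0.
Qed.

Lemma pderiv_step_le x (k : 'I_n) : (forall i, 0 < x i) ->
  x k * meval (trunc x k) (pderiv k) <= meval (trunc x k.+1) (pderiv k.+1).
Proof.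
move=> x0; have n0 : (0 < n)%N by apply: leq_trans (ltn_ord k).
have [h s q] := pderiv_props (ltn_ord k).
rewrite pderiv_ord (meval_eq _ (truncS x k)).
have [k0|k0] := posnP k; last first.
  by apply: mderiv_le h s q _ _; [exact: trunc_nonneg|exact: ltW].
have h1 : pderiv k.+1 \is ishomog1 1 mdeg by have -> : 1%N = k.+1 by rewrite k0.
have T0 : trunc x k =1 (fun=> 0) by move=> i; rewrite /trunc k0.
have T1 : (fun i => trunc x k i + x k * unitvec C k i) =1
    (fun i => x k * unitvec C k i) by move=> i /=; rewrite T0 add0r.
by rewrite (meval_eq _ T0) (meval_eq _ T1) (homog1_line _ _ h1).
Qed.

(** Induction on the number [j] of differentiated variables, starting from the last one; each step
    moves one [x k] into the product. *)
Lemma pderiv0_le x : (forall i, 0 < x i) ->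
  \prod_i x i * meval (fun=> 0) (pderiv 0) <= meval x p.
Proof.
move=> x0.
suff H j : (j <= n)%N -> \prod_(i < n | (n - j <= i)%N) x i *
    meval (trunc x (n - j)) (pderiv (n - j)) <= meval x p.
  by have := H n (leqnn n); rewrite subnn.
elim: j => [_|j IH jn].
  rewrite subn0 big1 ?mul1r => [|i]; last by rewrite leqNgt ltn_ord.
  rewrite /pderiv drop_oversize ?size_enum_ord//= (meval_eq _ (v2 := x))//.
  by move=> i; rewrite /trunc ltn_ord.
apply: le_trans (IH (ltnW jn)).
have [k kE] : {k : 'I_n | k = (n - j.+1)%N :> nat}.
  have jn' : (n - j.+1 < n)%N by lia.
  by exists (Ordinal jn').
have E : (n - j = k.+1)%N by lia.
rewrite E -kE (bigD1 k)//= (eq_bigl (fun i : 'I_n => k < i)%N); last first.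
  by move=> i; rewrite [RHS]ltn_neqAle andbC eq_sym val_eqE.
rewrite [x k * _]mulrC -mulrA ler_wpM2l ?pderiv_step_le//.
by rewrite prodr_ge0// => i _; apply: ltW.
Qed.

(* With [mderiv_ge], this makes the successive losses telescope to [n! / n^n]. *)
Lemma vdw_factor_step k :
  k.+1%:R ^+ k.+1 / k.+1`!%:R * (k%:R / k.+1%:R) ^+ k = k%:R ^+ k / k`!%:R :> C.
Proof.
rewrite factS natrM exprS expr_div_n.
have f0 : k`!%:R != 0 :> C by rewrite pnatr_eq0 -lt0n fact_gt0.
have k0 : k.+1%:R != 0 :> C by rewrite pnatr_eq0.
have k1 : k.+1%:R ^+ k != 0 :> C by rewrite expf_neq0.
have gen (a b c d : C) : a != 0 -> b != 0 -> c != 0 ->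
    b * a / (b * c) * (d / a) = d / c by move=> *; field; apply/and3P.
exact: gen.
Qed.

Lemma pderiv0_ge (c : C) :
  (forall x, (forall i, 0 < x i) -> c * \prod_i x i <= meval x p) ->
  c * (n`!%:R / n%:R ^+ n) <= meval (fun=> 0) (pderiv 0).
Proof.
(* [K k] is the factor accumulated when [k] variables remain: [K n = 1] and [K 0 = n! / n^n]. *)
move=> hc; pose K k : C := n`!%:R / n%:R ^+ n * (k%:R ^+ k / k`!%:R).
have n0n : n%:R ^+ n != 0 :> C.
  by case: (n) => [|m]; rewrite ?expr0 ?oner_eq0 ?expf_neq0 ?pnatr_eq0.
have nf : n`!%:R != 0 :> C by rewrite pnatr_eq0 -lt0n fact_gt0.
suff H j : (j <= n)%N -> forall x, (forall i, 0 < x i) ->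
    c * K (n - j)%N * \prod_(i < n | (i < n - j)%N) x i <=
    meval (trunc x (n - j)) (pderiv (n - j)).
  have := H n (leqnn n) (fun=> 1) (fun=> ltr01).
  by rewrite subnn big1// mulr1 /K expr0 fact0 divr1 mulr1.
elim: j => [_ x x0|j IH jn x x0].
  have -> : K (n - 0)%N = 1.
    by rewrite subn0 /K mulf_div [n`!%:R * _]mulrC divff// mulf_neq0.
  rewrite mulr1 subn0.
  rewrite (eq_bigl predT) => [|i]; last by rewrite ltn_ord.
  rewrite /pderiv drop_oversize ?size_enum_ord//= (meval_eq _ (v2 := x)) ?hc//.
  by move=> i; rewrite /trunc ltn_ord.
have [k kE] : {k : 'I_n | k = (n - j.+1)%N :> nat}.
  have jn' : (n - j.+1 < n)%N by lia.
  by exists (Ordinal jn').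
have E : (n - j = k.+1)%N by lia.
have n0 : (0 < n)%N by lia.
rewrite -kE {kE}.
rewrite E in IH.
(* The coordinate of index [k] is freed, since [mderiv_ge] needs the bound for every positive
   [t]. *)
have {IH} IH (t : C) : 0 < t ->
    c * K k.+1 * \prod_(i < n | (i < k)%N) x i * t <=
    meval (fun i => trunc x k i + t * unitvec C k i) (pderiv k.+1).
  move=> t0; pose y i := if i == k then t else x i.
  have y0 i : 0 < y i by rewrite /y; case: ifP.
  have := IH (ltnW jn) y y0; rewrite (meval_eq _ (truncS y k)).
  have yk : y k = t by rewrite /y eqxx.
  rewrite (bigD1 k)//= yk [t * _]mulrC [_ * (_ * t)]mulrA.
  have -> : \prod_(i < n | (i < k.+1)%N && (i != k)) y i = \prod_(i < n | (i < k)%N) x i.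
    apply: eq_big => [i|i /andP[_ /negbTE ik]]; last by rewrite /y ik.
    by rewrite ltnS [RHS]ltn_neqAle andbC.
  rewrite (meval_eq _ (v2 := fun i => trunc x k i + t * unitvec C k i))// => i.
  rewrite /trunc; case: ifP => // ik; congr (_ + _).
  by rewrite /y; case: eqP => // ik'; rewrite ik' ltnn in ik.
have [h s q] := pderiv_props (ltn_ord k).
have Kk : K k = K k.+1 * (k%:R / k.+1%:R) ^+ k by rewrite /K -[RHS]mulrA vdw_factor_step.
rewrite pderiv_ord Kk; have [k0|k0] := posnP k.
  have h1 : pderiv k.+1 \is ishomog1 1 mdeg by have -> : 1%N = k.+1 by rewrite k0.
  have T0 : trunc x k =1 (fun=> 0) by move=> i; rewrite /trunc k0.
  have T1 : (fun i => trunc x k i + 1 * unitvec C k i) =1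
    (fun i => 1 * unitvec C k i) by move=> i /=; rewrite T0 add0r.
  have := IH 1 ltr01; rewrite (meval_eq _ T0) (meval_eq _ T1) (homog1_line _ _ h1).
  have -> : (k%:R / k.+1%:R) ^+ k = 1 :> C by rewrite k0 expr0.
  by rewrite !mulr1 mul1r.
(* [mderiv_ge] concerns degree [d + 2]; here the degree is [k + 1], hence [d = k - 1]. *)
have dk : k.-1.+1 = k by rewrite prednK.
have := @mderiv_ge n C k.-1 (pderiv k.+1) k (trunc x k) _ _ s q _ IH.
rewrite dk => H; rewrite mulrA mulrAC; apply: H => //.
exact: trunc_nonneg.
Qed.

End CapacityInequalities.

(** * Passage from positive definite to positive semidefinite matrices *)

Section Perturbation.
Variable R : realType.
Local Notation C := (R[i]).

Lemma Re_le (z w : C) : z <= w -> complex.Re z <= complex.Re w.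
Proof. by rewrite lecE => /andP[]. Qed.

Lemma Re_realM (a : R) (z : C) : complex.Re (a%:C * z) = a * complex.Re z.
Proof. by case: z => x y /=; rewrite mul0r subr0. Qed.

(** On real arguments the real part of [P] is a real polynomial, so the bound survives the limit
    from the right at 0. *)
Lemma Re_horner_ge (P : {poly C}) (c : R) :
  (forall e : R, 0 < e -> c <= complex.Re P.[e%:C]) -> c <= complex.Re P.[0].
Proof.
move=> H; pose Q := \poly_(i < size P) complex.Re P`_i.
have QE e : Q.[e] = complex.Re P.[e%:C].
  rewrite horner_poly horner_coef raddf_sum /=; apply: eq_bigr => i _.
  by rewrite -rmorphXn /= [P`_i * _]mulrC Re_realM mulrC.
have := QE 0; rewrite /= -[0%:C]/(0 : C) => <-.
have cQ : Q.[x] @[x --> (0 : R)^'+] --> Q.[0].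
  by apply: cvg_at_right_filter; exact: continuous_horner.
apply: (cvgr_to_ge cQ).
near=> x; rewrite QE; apply: H; near: x; exact: nbhs_right_gt.
Unshelve. all: by end_near.
Qed.

(** The ring is general because the entries are complex numbers in some uses and multivariate
    polynomials in another. *)
Lemma det_perturb_poly (T : comNzRingType) (n : nat) (A W : 'M[T]_n) :
  exists P : {poly T}, forall e, \det (A + e *: W) = P.[e].
Proof.
exists (\det (map_mx polyC A + 'X *: map_mx polyC W)) => e.
rewrite -horner_evalE -det_map_mx; congr (\det _); apply/matrixP => i j.
by rewrite !mxE /= horner_evalE hornerD hornerM hornerX !hornerC.
Qed.

Lemma mixed_discriminant_ext (n : nat) (B B' : 'I_n -> 'M[C]_n) : B =1 B' ->
  mixed_discriminant B = mixed_discriminant B'.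
Proof. by move=> BB; congr mixed_discriminant; apply/funext. Qed.

(** The mixed derivative at 0 is a linear functional [L]; applying it to each coefficient of the
    determinant, expanded in powers of the parameter, gives the polynomial. *)
Lemma mixed_discriminant_perturb_poly (n : nat) (B W : 'I_n -> 'M[C]_n) :
  exists P : {poly C}, forall e,
    mixed_discriminant (fun i => B i + e *: W i) = P.[e].
Proof.
pose L (q : mpoly n C) : C := meval (fun=> 0) (foldr (@mderiv n C) q (enum 'I_n)).
have LD : {morph L : p q / p + q}.
  move=> p q; rewrite /L -mevalD; congr (meval _ _).
  by elim: (enum _) => //= i s ->; rewrite mderivD.
have LZ c q : L (c *: q) = c * L q.
  rewrite /L -mevalZ; congr (meval _ _).
  by elim: (enum _) => //= i s ->; rewrite mderivZ.
have L0 : L 0 = 0 by rewrite -(scale0r 0) LZ mul0r.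
have [Q QE] := det_perturb_poly
  (\sum_(i < n) mpolyX C (mnm1 i) *: map_mx (@mpolyC n C) (B i))
  (\sum_(i < n) mpolyX C (mnm1 i) *: map_mx (@mpolyC n C) (W i)).
exists (\poly_(j < size Q) L Q`_j) => e.
have -> : mixed_discriminant (fun i => B i + e *: W i) = L Q.[mpolyC n e].
  rewrite -QE /mixed_discriminant /det_pencil -/(L _); congr (L (\det _)).
  rewrite scaler_sumr -big_split; apply: eq_bigr => k _ /=.
  rewrite scalerA [mpolyC n e * _]mulrC -scalerA -scalerDr; congr (_ *: _).
  by apply/matrixP => i j; rewrite !mxE mpolyCD mpolyCM.
rewrite horner_poly horner_coef (big_morph L LD L0); apply: eq_bigr => j _.
by rewrite mulrC -rmorphXn /= mul_mpolyC LZ mulrC.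
Qed.

Lemma posdef_sum (n : nat) (x : 'I_n -> C) (F : 'I_n -> 'M[C]_n) :
  (forall i, 0 < x i) -> (forall i, posdef (F i)) -> posdef (\sum_i x i *: F i).
Proof.
move=> x0 pF v v0; rewrite qform_sum; have /rV0Pn[j _] := v0.
rewrite (bigD1 j)//= ltr_pwDl ?qformZ ?mulr_gt0 ?pF//.
by rewrite sumr_ge0// => i _; rewrite qformZ mulr_ge0// ltW// pF.
Qed.

Section MixedDiscriminant.
Variables (n : nat) (B : 'I_n -> 'M[C]_n).
Hypothesis psdB : forall i, possemidef (B i).

Let Be (e : R) i := B i + e%:C *: 1%:M.

Lemma posdef_Be e i : 0 < e -> posdef (Be e i).
Proof. by move=> e0; apply: posdefD1 => //; rewrite ltcR. Qed.

Lemma mixed_discriminant_pderiv (F : 'I_n -> 'M[C]_n) :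
  mixed_discriminant F = meval (fun=> 0) (pderiv (det_pencil F) 0).
Proof. by rewrite /mixed_discriminant /pderiv drop0. Qed.

Lemma mixed_discriminant_le_det (x : 'I_n -> R) : (forall i, 0 < x i) ->
  \prod_i x i * complex.Re (mixed_discriminant B) <=
  complex.Re (\det (\sum_i (x i)%:C *: B i)).
Proof.
move=> x0; have [P1 P1E] := det_perturb_poly (\sum_i (x i)%:C *: B i)
  (\sum_i (x i)%:C *: 1%:M).
have [P2 P2E] := mixed_discriminant_perturb_poly B (fun=> 1%:M).
have D0 : mixed_discriminant (fun i => B i + 0 *: 1%:M) = mixed_discriminant B.
  by apply: mixed_discriminant_ext => i; rewrite scale0r addr0.
rewrite -subr_ge0.
have -> : complex.Re (\det (\sum_i (x i)%:C *: B i)) -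
    \prod_i x i * complex.Re (mixed_discriminant B) =
    complex.Re (P1 - (\prod_i x i)%:C *: P2).[0].
  rewrite hornerD hornerN hornerZ -P1E -P2E D0 scale0r addr0 raddfB /=.
  by rewrite Re_realM.
apply: Re_horner_ge => e e0.
rewrite hornerD hornerN hornerZ -P1E -P2E raddfB /= Re_realM subr_ge0.
rewrite -Re_realM; apply: Re_le; rewrite mixed_discriminant_pderiv rmorph_prod /=.
have -> : \sum_i (x i)%:C *: B i + e%:C *: \sum_i (x i)%:C *: 1%:M =
    \sum_i (x i)%:C *: Be e i.
  rewrite scaler_sumr -big_split /=; apply: eq_bigr => i _.
  by rewrite /Be scalerDr !scalerA [e%:C * _]mulrC.
rewrite -meval_det_pencil.
have pBe i := posdef_Be i e0.
apply: pderiv0_le.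
- exact: homog_det_pencil.
- exact: stable_det_pencil.
- exact: pos_det_pencil.
- by move=> i; rewrite ltcR.
Qed.

Lemma mixed_discriminant_ge (c : R) :
  (forall x : 'I_n -> R, (forall i, 0 < x i) ->
     c * \prod_i x i <= complex.Re (\det (\sum_i (x i)%:C *: B i))) ->
  c * (n`!%:R / n%:R ^+ n) <= complex.Re (mixed_discriminant B).
Proof.
move=> hc; have [P PE] := mixed_discriminant_perturb_poly B (fun=> 1%:M).
have -> : mixed_discriminant B = P.[0].
  by rewrite -PE; apply: mixed_discriminant_ext => i; rewrite scale0r addr0.
apply: Re_horner_ge => e e0; rewrite -PE.
have pBe i := posdef_Be i e0.
suff : (c * (n`!%:R / n%:R ^+ n))%:C <=
    mixed_discriminant (fun i => B i + e%:C *: 1%:M) by move/Re_le.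
rewrite mixed_discriminant_pderiv.
have -> : (c * (n`!%:R / n%:R ^+ n))%:C = c%:C * (n`!%:R / n%:R ^+ n) :> C.
  by rewrite rmorphM /= rmorphM /= fmorphV rmorphXn /= !rmorph_nat.
apply: pderiv0_ge.
- exact: homog_det_pencil.
- exact: stable_det_pencil.
- exact: pos_det_pencil.
move=> x x0; rewrite meval_det_pencil.
(* [pderiv0_ge] ranges over positive elements of [C], which are real, whereas [hc] takes points over
   [R]. *)
have xE i : x i = (complex.Re (x i))%:C by rewrite RRe_real// gtr0_real.
pose y i := complex.Re (x i).
have y0 i : 0 < y i by rewrite -ltcR /y -xE.
have psdS : possemidef (\sum_i x i *: B i) by apply: possemidef_sum => // i; apply: ltW.
(* The bound [hc] concerns the unperturbed matrices; adding multiples of the identity can only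
   increase the determinant. *)
apply: le_trans (det_le (posdef_sum x0 pBe) psdS _); last first.
  rewrite -sumrB => v; rewrite qform_sum sumr_ge0// => i _.
  rewrite -scalerBr /Be addrC addKr !qformZ !mulr_ge0 ?(ltW (x0 _))//.
    by rewrite ler0c ltW.
  exact/posdef_possemidef/posdef1.
have -> : \prod_i x i = (\prod_i y i)%:C.
  by rewrite rmorph_prod; apply: eq_bigr => i _; rewrite xE.
rewrite -rmorphM /= -(RRe_real (ger0_real (det_possemidef_ge0 psdS))) lecR.
rewrite (eq_bigr (fun i => (y i)%:C *: B i)) ?hc// => i _.
by rewrite {1}xE.
Qed.

End MixedDiscriminant.

(** * Capacity compared with the mixed discriminant *)

Section Capacity.
Variables (n : nat) (B : 'I_n -> 'M[C]_n).
Hypothesis psdB : forall i, possemidef (B i).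

Lemma Re_det_sum_ge0 (x : 'I_n -> R) : (forall i, 0 <= x i) ->
  0 <= complex.Re (\det (\sum_i (x i)%:C *: B i)).
Proof.
move=> x0; apply: (@Re_le 0); apply: det_possemidef_ge0.
by apply: possemidef_sum => // i; rewrite ler0c.
Qed.

Lemma le_capacity (c : R) :
  (forall x : 'I_n -> R, (forall i, 0 < x i) -> \prod_i x i = 1 ->
     c <= complex.Re (\det (\sum_i (x i)%:C *: B i))) ->
  c <= capacity B.
Proof.
move=> H; apply: lb_le_inf; last by move=> _ [x [x0 x1] <-]; apply: H.
exists (complex.Re (\det (\sum_i (1 : R)%:C *: B i))), (fun=> 1) => //=.
by split=> //; rewrite big1.
Qed.

Lemma capacity_ge0 : 0 <= capacity B.
Proof. by apply: le_capacity => x x0 _; apply: Re_det_sum_ge0 => i; apply: ltW. Qed.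

(** Dividing [x] by its geometric mean [g] makes the product 1 and divides the determinant by [g^n].
    The case [n = 0] is separate because there is no [n]-th root. *)
Lemma capacity_le (x : 'I_n -> R) : (forall i, 0 < x i) ->
  capacity B * \prod_i x i <= complex.Re (\det (\sum_i (x i)%:C *: B i)).
Proof.
have H y : (forall i, 0 < y i) -> \prod_i y i = 1 ->
    capacity B <= complex.Re (\det (\sum_i (y i)%:C *: B i)).
  move=> y0 y1; apply: ge_inf; last by exists y.
  by exists 0 => _ [z [z0 _] <-]; apply: Re_det_sum_ge0 => i; apply: ltW.
move=> x0; have P0 : 0 < \prod_i x i by apply: prodr_gt0.
have [n0|n0] := posnP n.
  have x1 : \prod_i x i = 1.
    by rewrite big1// => i _; have := ltn_ord i; rewrite [X in (_ < X)%N]n0.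
  by rewrite x1 mulr1 H.
pose g := (\prod_i x i) `^ n%:R^-1.
have g0 : 0 < g by rewrite powR_gt0.
have gn : g ^+ n = \prod_i x i.
  by rewrite -powR_mulrn ?ltW// -powRrM mulVf ?powRr1 ?ltW// pnatr_eq0 -lt0n.
have := H (fun i => x i / g) _ _; rewrite -ler_pdivlMr//.
have -> : \sum_i (x i / g)%:C *: B i = (g^-1)%:C *: \sum_i (x i)%:C *: B i.
  rewrite scaler_sumr; apply: eq_bigr => i _.
  by rewrite scalerA mulrC rmorphM.
rewrite detZ -rmorphXn /= Re_realM exprVn gn mulrC; apply.
- by move=> i; rewrite divr_gt0.
- by rewrite big_split /= prodr_const card_ord exprVn gn divff// gt_eqF.
Qed.

Lemma mixed_discriminant_le_capacity :
  complex.Re (mixed_discriminant B) <= capacity B.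
Proof.
apply: le_capacity => x x0 x1.
by have := mixed_discriminant_le_det psdB x0; rewrite x1 mul1r.
Qed.

Lemma capacity_le_mixed_discriminant :
  capacity B * (n`!%:R / n%:R ^+ n) <= complex.Re (mixed_discriminant B).
Proof. by apply: mixed_discriminant_ge => // x x0; apply: capacity_le. Qed.

End Capacity.

End Perturbation.

(** * Log-concavity of the determinant *)

Section LogConcavity.
Variable R : realType.
Local Notation C := (R[i]).

(** Multiply [a <= exp (a - 1)] over the eigenvalues [a] of [Z S^-1]. *)
Lemma det_le_expR_trace (n : nat) (S Z : 'M[C]_n) : posdef S -> possemidef Z ->
  complex.Re (\det Z) <=
  complex.Re (\det S) * expR (complex.Re (\tr (Z *m invmx S)) - n%:R).
Proof.
move=> pS pZ; have [s [ss -> -> sv]] := relative_eigenvalues Z pS.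
have s0 := relative_eigenvalues_ge0 pS pZ sv.
have dS : \det S = (complex.Re (\det S))%:C.
  by rewrite RRe_real// gtr0_real// det_posdef_gt0.
have dS0 : 0 <= complex.Re (\det S) by apply/(@Re_le _ 0)/ltW/det_posdef_gt0.
rewrite {1}dS Re_realM ler_wpM2l// -ss {ss sv}.
elim: s s0 => [|a s IH] s0; first by rewrite !big_nil /= subr0 expR0.
have a0 : 0 <= a by apply: s0; rewrite mem_head.
have {}IH : complex.Re (\prod_(a <- s) a) <=
    expR (complex.Re (\sum_(a <- s) a) - (size s)%:R).
  by apply: IH => b bs; apply: s0; rewrite inE bs orbT.
have aE : a = (complex.Re a)%:C by rewrite RRe_real// ger0_real.
have a0' : 0 <= complex.Re a by apply: (@Re_le _ 0).
rewrite !big_cons {1}aE Re_realM raddfD /= -natr1.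
have -> (u v w : R) : u + v - (w + 1) = (u - 1) + (v - w) by ring.
rewrite expRD ler_pM//.
  apply: (@Re_le _ 0); rewrite big_seq; apply: prodr_ge0 => b bs.
  by apply: s0; rewrite inE bs orbT.
by have := expR_ge1Dx (complex.Re a - 1); rewrite addrC subrK.
Qed.

(** The trace bound is applied to each [Z i] against one perturbed [S'], and the logarithms are
    averaged. The averaged traces add up to the trace of [S S'^-1], which is at most [n]. *)
Lemma det_log_concave (n m : nat) (Z : 'I_m -> 'M[C]_n) (gamma : 'I_m -> R) :
  (forall i, possemidef (Z i)) -> (forall i, 0 <= gamma i) ->
  \sum_i gamma i = 1 ->
  (forall i, 0 < gamma i -> 0 < complex.Re (\det (Z i))) ->
  expR (\sum_i gamma i * ln (complex.Re (\det (Z i)))) <=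
  complex.Re (\det (\sum_i (gamma i)%:C *: Z i)).
Proof.
move=> pZ g0 g1 dZ; set S := \sum_i (gamma i)%:C *: Z i.
have pS : possemidef S by apply: possemidef_sum => // i; rewrite ler0c.
have [P PE] := det_perturb_poly S 1%:M.
have -> : \det S = P.[0] by rewrite -PE scale0r addr0.
apply: Re_horner_ge => e e0; rewrite -PE.
have e0' : 0 < e%:C :> C by rewrite ltcR.
set S' := S + _; have pS' : posdef S' by apply: posdefD1.
have dS' : 0 < complex.Re (\det S').
  by have := det_posdef_gt0 pS'; rewrite ltcE => /andP[].
pose tau i := complex.Re (\tr (Z i *m invmx S')).
have tau_sum : \sum_i gamma i * tau i <= n%:R.
  have -> : \sum_i gamma i * tau i = complex.Re (\tr (S *m invmx S')).
    pose f (M : 'M[C]_n) := complex.Re (\tr M).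
    have fD : {morph f : M N / M + N} by move=> M N; rewrite /f mxtraceD raddfD.
    have f0 : f 0 = 0 by rewrite /f mxtrace0.
    rewrite /S mulmx_suml -[RHS]/(f _) (big_morph f fD f0); apply: eq_bigr => i _.
    rewrite /f.
    by rewrite -scalemxAl mxtraceZ Re_realM.
  have [s [ss _ -> sv]] := relative_eigenvalues S pS'.
  have /= s1 := relative_eigenvalues_le1 pS' _ sv.
  have {}s1 : {in s, forall a, a <= 1}.
    apply: s1; rewrite /S' addrC addKr => v.
    rewrite qformZ mulr_ge0 ?(ltW e0')//; exact/posdef_possemidef/posdef1.
  have -> : n%:R = complex.Re (n%:R : C) by rewrite -(rmorph_nat (real_complex R)).
  apply: Re_le; rewrite -ss -sum1_size natr_sum.
  by rewrite big_seq [leRHS]big_seq ler_sum.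
rewrite -[leRHS]lnK ?posrE// ler_expR.
apply: (@le_trans _ _ (\sum_i gamma i * (ln (complex.Re (\det S')) + (tau i - n%:R)))).
  apply: ler_sum => i _; have [->|gi] := eqVneq (gamma i) 0; first by rewrite !mul0r.
  rewrite ler_wpM2l// -[X in _ <= _ + X]expRK -lnM ?posrE ?expR_gt0//.
  rewrite ler_ln ?posrE ?mulr_gt0 ?expR_gt0//.
    exact: det_le_expR_trace.
  by apply: dZ; rewrite lt_def gi g0.
under eq_bigr do rewrite mulrDr mulrBr.
rewrite big_split sumrB /= -!mulr_suml g1 !mul1r.
by rewrite gerDl subr_le0.
Qed.

End LogConcavity.

(** * Repeated tuples as reindexed tuples *)

Lemma repeat_tuple_index (n : nat) (alpha : 'I_n -> nat) : in_L alpha ->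
  exists kappa : 'I_n -> 'I_n,
    (forall (R : realType) (A : 'I_n -> 'M[R[i]]_n),
       repeat_tuple A alpha =1 A \o kappa) /\
    (forall k, #|[pred j | kappa j == k]| = alpha k).
Proof.
move=> La; pose s := flatten [seq nseq (alpha k) k | k <- enum 'I_n].
have ss : size s = n.
  rewrite size_flatten /shape -map_comp sumnE big_map -[RHS]La big_enum /=.
  by apply: eq_bigr => k _; rewrite size_nseq.
(* [kappa j] is the block containing position [j]. As [s] has length [n], the default [j] is never
   returned; it only supplies an inhabitant of ['I_n]. *)
pose kappa (j : 'I_n) := nth j s j; exists kappa; split=> [R A j|k].
  rewrite /repeat_tuple /= /kappa -(nth_map j 0 A) ?ss//; congr nth.
  rewrite /s map_flatten -map_comp; congr flatten; apply: eq_map => k /=.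
  by rewrite map_nseq.
have sE : s = [seq kappa j | j <- enum 'I_n].
  have [n0|n0] := posnP n.
    have e0 : enum 'I_n = [::] by apply/size0nil; rewrite size_enum_ord.
    by rewrite /s e0.
  have sm : size [seq kappa j | j <- enum 'I_n] = n by rewrite size_map size_enum_ord.
  apply: (@eq_from_nth _ (Ordinal n0)) => [|i]; rewrite ss ?sm// => ni.
  rewrite (nth_map (Ordinal n0)) ?size_enum_ord//.
  rewrite (nth_ord_enum _ (Ordinal ni)) /kappa /=.
  by apply: set_nth_default; rewrite ss.
transitivity (count_mem k s).
  rewrite cardE size_filter sE [RHS]count_map [in RHS]enumT.
  by apply: eq_count.
rewrite /s count_flatten -map_comp sumnE big_map big_enum /= (bigD1 k)//= count_nseq.
rewrite /= eqxx mul1n big1 ?addn0// => i ik.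
by rewrite count_nseq /= (negbTE ik).
Qed.

(** * Log-concavity of the capacity in the multiplicities *)

Section CapacityConcavity.
Variables (R : realType) (n : nat) (A : 'I_n -> 'M[R[i]]_n).
Hypothesis psdA : forall k, possemidef (A k).

Lemma sum_fibers (V : nmodType) (kappa : 'I_n -> 'I_n) (alpha : 'I_n -> nat)
    (F : 'I_n -> V) :
  (forall k, #|[pred j | kappa j == k]| = alpha k) ->
  \sum_j F (kappa j) = \sum_k F k *+ alpha k.
Proof.
move=> ka; rewrite (partition_big kappa predT)//=; apply: eq_bigr => k _.
rewrite (eq_bigr (fun=> F k)) => [|j /eqP-> //].
by rewrite sumr_const -ka.
Qed.

Lemma Cap_ge0 alpha : in_L alpha -> 0 <= Cap_ A alpha.
Proof.
move=> /repeat_tuple_index[kappa [rE _]].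
by apply: capacity_ge0 => i; rewrite rE; apply: psdA.
Qed.

(** [capacity_le] at the point equal to [w k] on the block of [k]. The product is an exponential so
    that exponents for different [alpha] can be averaged. *)
Lemma Cap_le_det alpha (w : 'I_n -> R) : in_L alpha -> (forall k, 0 < w k) ->
  Cap_ A alpha * expR (\sum_k (alpha k)%:R * ln (w k)) <=
  complex.Re (\det (\sum_k ((alpha k)%:R * w k)%:C *: A k)).
Proof.
move=> /repeat_tuple_index[kappa [rE ka]] w0.
have psdB i : possemidef (repeat_tuple A alpha i) by rewrite rE; apply: psdA.
have := capacity_le psdB (fun j => w0 (kappa j)).
have -> : \prod_j w (kappa j) = expR (\sum_k (alpha k)%:R * ln (w k)).
  under [in RHS]eq_bigr do rewrite mulr_natl.
  rewrite -(sum_fibers _ ka) expR_sum; apply: eq_bigr => j _.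
  by rewrite lnK ?posrE.
have -> // : \sum_i (w (kappa i))%:C *: repeat_tuple A alpha i =
   \sum_k ((alpha k)%:R * w k)%:C *: A k.
under eq_bigr do rewrite rE /=.
rewrite (sum_fibers (fun k => (w k)%:C *: A k) ka); apply: eq_bigr => k _.
by rewrite scalerMnl -rmorphMn /= mulr_natl.
Qed.

(** The matrix at [x] depends only on the block sums of [x], so [x] may be replaced by its block
    means [w]. The result is linear in [alpha], hence an average of matrices [Z i] belonging to the
    [alphas i], to which [det_log_concave] applies. *)
Lemma capacity_log_concave (m : nat) (alpha : 'I_n -> nat)
    (alphas : 'I_m -> 'I_n -> nat) (gamma : 'I_m -> R) :
  in_L alpha -> (forall i, in_L (alphas i)) -> (forall i, 0 <= gamma i) ->
  \sum_i gamma i = 1 ->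
  (forall k, (alpha k)%:R = \sum_i gamma i * (alphas i k)%:R) ->
  (forall i, 0 < gamma i -> 0 < Cap_ A (alphas i)) ->
  expR (\sum_i gamma i * ln (Cap_ A (alphas i))) <= Cap_ A alpha.
Proof.
move=> La Las g0 g1 hcomb hcap.
have [kappa [rE ka]] := repeat_tuple_index La.
have psdB i : possemidef (repeat_tuple A alpha i) by rewrite rE; apply: psdA.
apply: le_capacity => // x x0 x1.
pose y k := \sum_(j | kappa j == k) x j.
(* An empty block has no mean. The value 1 keeps [w] positive, as [Cap_le_det] requires for the
   [alphas i]. *)
pose w k := if alpha k == 0%N then 1 else y k / (alpha k)%:R.
have y0 k : (0 < alpha k)%N -> 0 < y k.
  rewrite -ka => /card_gt0P[j jk]; rewrite /y (bigD1 j)//= ltr_pwDl//.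
  by rewrite sumr_ge0// => i _; apply: ltW.
have w0 k : 0 < w k.
  by rewrite /w; case: posnP => // ak; rewrite divr_gt0 ?y0// ltr0n.
have awy k : (alpha k)%:R * w k = y k.
  rewrite /w; case: posnP => [ak|ak]; last by rewrite mulrC divfK// pnatr_eq0 -lt0n.
  rewrite ak mul0r /y big1// => j jk; move: ak.
  by rewrite -ka (cardD1 j) inE jk.
have AG k : \prod_(j | kappa j == k) x j <= w k ^+ alpha k.
  have := @leif_AGM R _ [pred j | kappa j == k] x; rewrite ka => /(_ _)[].
    by move=> j _; apply: ltW.
  move=> + _; rewrite /w; case: posnP => // ->; rewrite !expr0.
  by rewrite -/(y k).
(* By AM-GM in each block, the means have weighted product at least that of [x], which is 1. *)
have w1 : 0 <= \sum_k (alpha k)%:R * ln (w k).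
  have : 1 <= \prod_k w k ^+ alpha k.
    rewrite -[leLHS]x1 (partition_big kappa predT)//=; apply: ler_prod => k _.
    by rewrite AG prodr_ge0// => j _; apply: ltW.
  have -> : \prod_k w k ^+ alpha k = expR (\sum_k (alpha k)%:R * ln (w k)).
    rewrite expR_sum; apply: eq_bigr => k _.
    by rewrite mulrC expRM_natr lnK ?posrE.
  by rewrite -[X in X <= _]expR0 ler_expR.
pose Z i := \sum_k ((alphas i k)%:R * w k)%:C *: A k.
have pZ i : possemidef (Z i).
  by apply: possemidef_sum => // k; rewrite ler0c mulr_ge0// ltW.
have -> : \sum_i (x i)%:C *: repeat_tuple A alpha i = \sum_i (gamma i)%:C *: Z i.
  transitivity (\sum_k (y k)%:C *: A k).
    rewrite (partition_big kappa predT)//=; apply: eq_bigr => k _.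
    rewrite /y rmorph_sum /= scaler_suml; apply: eq_bigr => j /eqP <-.
    by rewrite rE.
  under [in RHS]eq_bigr do rewrite scaler_sumr.
  rewrite exchange_big; apply: eq_bigr => k _ /=.
  under [in RHS]eq_bigr do rewrite scalerA -rmorphM mulrA.
  rewrite -scaler_suml -rmorph_sum -mulr_suml -hcomb awy.
  by [].
have dZ i : Cap_ A (alphas i) * expR (\sum_k (alphas i k)%:R * ln (w k)) <=
  complex.Re (\det (Z i)) by apply: Cap_le_det.
have dZ0 i : 0 < gamma i -> 0 < complex.Re (\det (Z i)).
  by move=> /hcap c0; apply: lt_le_trans (dZ i); rewrite mulr_gt0// expR_gt0.
apply: le_trans (det_log_concave pZ g0 g1 dZ0).
rewrite ler_expR.
(* The added terms average to the sum in [w1] by [hcomb], so they only enlarge the sum. *)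
apply: (@le_trans _ _ (\sum_i gamma i * (ln (Cap_ A (alphas i)) +
    \sum_k (alphas i k)%:R * ln (w k)))).
  under [leRHS]eq_bigr do rewrite mulrDr.
  rewrite big_split /= lerDl.
  under eq_bigr do rewrite mulr_sumr.
  rewrite exchange_big /= (le_trans w1)// ler_sum// => k _.
  under eq_bigr do rewrite mulrA.
  by rewrite -mulr_suml hcomb.
apply: ler_sum => i _; have [->|gi] := eqVneq (gamma i) 0; first by rewrite !mul0r.
have gi0 : 0 < gamma i by rewrite lt_def gi g0.
rewrite ler_wpM2l// -[X in _ + X <= _]expRK -lnM ?posrE ?expR_gt0 ?hcap//.
by rewrite ler_ln ?posrE ?dZ0// mulr_gt0 ?expR_gt0 ?hcap.
Qed.

End CapacityConcavity.

(** * Weighted sums of extended logarithms *)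

Section ExtendedLog.
Variable R : realType.

(** If some [c i <= 0] has positive weight, the left side is [-oo]. Otherwise every term is finite,
    those of weight 0 vanish, and the real inequality suffices. *)
Lemma sum_lne_le (m : nat) (gamma c : 'I_m -> R) (d : R) :
  (forall i, 0 <= gamma i) ->
  ((forall i, 0 < gamma i -> 0 < c i) ->
     expR (\sum_i gamma i * ln (c i)) <= d) ->
  (\sum_i (gamma i)%:E * lne (c i)%:E <= lne d%:E)%E.
Proof.
move=> g0 H; have [/existsP[i /andP[gi ci]]|/existsPn nex] :=
  boolP [exists i, (0 < gamma i) && (c i <= 0)].
  suff -> : (\sum_i (gamma i)%:E * lne (c i)%:E = -oo)%E by rewrite leNye.
  apply/esum_eqNyP; exists i; split=> //.
  by rewrite le0_lneNy ?lee_fin// gt0_muleNy// lte_fin.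
have c0 i : 0 < gamma i -> 0 < c i.
  by move=> gi; have := nex i; rewrite gi /= -ltNge.
have Hd := H c0; have d0 : 0 < d by apply: lt_le_trans Hd; apply: expR_gt0.
rewrite (eq_bigr (fun i => (gamma i * ln (c i))%:E)) => [|i _]; last first.
  have [->|gi] := eqVneq (gamma i) 0; first by rewrite mul0e mul0r.
  by rewrite lne_EFin// c0// lt_def gi g0.
by rewrite sumEFin lne_EFin// lee_fin -ler_expR lnK ?posrE.
Qed.

Lemma lne_le_addr (a b q : R) : 0 <= a -> 0 <= b -> 0 < q -> a <= b * q ->
  (lne a%:E <= lne b%:E + (ln q)%:E)%E.
Proof.
move=> a0 b0 q0 abq; have [a_0|aN0] := eqVneq a 0.
  by rewrite le0_lneNy ?leNye// lee_fin a_0.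
have ap : 0 < a by rewrite lt_def aN0.
have bp : 0 < b by have := lt_le_trans ap abq; rewrite pmulr_lgt0.
by rewrite !lne_EFin// -EFinD -lnM ?posrE// lee_fin ler_ln ?posrE ?mulr_gt0.
Qed.

End ExtendedLog.

(** * Transfer from capacities to mixed discriminants *)

Section MixedDiscriminantBounds.
Variables (R : realType) (n : nat) (A : 'I_n -> 'M[R[i]]_n).
Hypothesis psdA : forall k, possemidef (A k).

Lemma M_le_Cap alpha : in_L alpha -> M_ A alpha <= Cap_ A alpha.
Proof.
move=> /repeat_tuple_index[kappa [rE _]].
by apply: mixed_discriminant_le_capacity => i; rewrite rE; apply: psdA.
Qed.

Lemma Cap_le_M alpha : in_L alpha ->
  Cap_ A alpha * (n`!%:R / n%:R ^+ n) <= M_ A alpha.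
Proof.
move=> /repeat_tuple_index[kappa [rE _]].
by apply: capacity_le_mixed_discriminant => i; rewrite rE; apply: psdA.
Qed.

End MixedDiscriminantBounds.

(* [lne] is the extended-real logarithm, with [lne 0 = -oo]; products follow
   the convention [0 * -oo = 0]. *)
Theorem theorem5p2 (R : realType) (n : nat) (A : 'I_n -> 'M[R[i]]_n)
    (hA : forall k : 'I_n, psdmx (A k))
    (m : nat) (alpha : 'I_n -> nat) (alphas : 'I_m -> 'I_n -> nat)
    (gamma : 'I_m -> R)
    (halpha : in_L alpha) (halphas : forall i : 'I_m, in_L (alphas i))
    (hgamma : forall i : 'I_m, 0 <= gamma i)
    (hgamma1 : \sum_(i < m) gamma i = 1)
    (hcomb : forall k : 'I_n,
       (alpha k)%:R = \sum_(i < m) gamma i * (alphas i k)%:R) :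
  (\sum_(i < m) (gamma i)%:E * lne (Cap_ A (alphas i))%:E
     <= lne (Cap_ A alpha)%:E)%E /\
  (\sum_(i < m) (gamma i)%:E * lne (M_ A (alphas i))%:E
     - lne ((n ^ n)%:R / n`!%:R)%:E
     <= lne (M_ A alpha)%:E)%E.
Proof.
have psdA k : possemidef (A k) by case: (hA k).
have nn0 : 0 < n%:R ^+ n :> R.
  by case: (n) => [|p]; rewrite ?expr0 ?exprn_gt0 ?ltr0n.
have nf0 : 0 < n`!%:R :> R by rewrite ltr0n fact_gt0.
have M0 b : in_L b -> 0 <= M_ A b.
  move=> Lb; apply: le_trans (Cap_le_M psdA Lb).
  by rewrite mulr_ge0 ?divr_ge0 ?(ltW nn0) ?(ltW nf0)// Cap_ge0.
have capH : (\sum_(i < m) (gamma i)%:E * lne (Cap_ A (alphas i))%:E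
     <= lne (Cap_ A alpha)%:E)%E.
  by apply: sum_lne_le => // c0; apply: capacity_log_concave.
split=> //; rewrite natrX.
have q0 : 0 < n%:R ^+ n / n`!%:R :> R by rewrite divr_gt0.
rewrite (lne_EFin q0) leeBlDr//.
have sumH : (\sum_(i < m) (gamma i)%:E * lne (M_ A (alphas i))%:E <=
    \sum_(i < m) (gamma i)%:E * lne (Cap_ A (alphas i))%:E)%E.
  apply: lee_sum => i _; apply: lee_wpmul2l; first by rewrite lee_fin.
  have Mi0 := M0 _ (halphas i); have MC := M_le_Cap psdA (halphas i).
  move: (M_ A _) (Cap_ A _) Mi0 MC => a b a0 ab.
  have b0 := le_trans a0 ab.
  by rewrite lee_lne ?in_itv /= ?leey ?andbT ?lee_fin.
(* Each [M_] is first enlarged to [Cap_], then concavity is applied, and only the single final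
   return from [Cap_] to [M_] costs the factor [n^n / n!]. *)
apply: le_trans sumH (le_trans capH _).
apply: lne_le_addr => //; [exact: Cap_ge0|exact: M0|].
have := Cap_le_M psdA halpha; move: (M_ A _) (Cap_ A _) => a b.
by rewrite -ler_pdivlMr ?divr_gt0// invf_div.
Qed.
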